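(* There is a one-to-one correspondence between the collection $\mathcal{SLG}$ of semigroup semilattices of groups and the collection $\mathcal{SLDWQ}$ of groupoids $(S,* )$ that are a semigroup semilattice $Y$ of double Ward quasigroups $(DW_\alpha,*|_{DW_\alpha},e_\alpha)$ $(\alpha\in Y)$ and that satisfy: (i) $(\{e_\alpha:\alpha\in Y\},* )\cong Y$ (in particular it is a semigroup semilattice); (ii) for all $\alpha,\beta,\gamma\in Y$ and $x_\alpha\in DW_\alpha$, $y_\beta\in DW_\beta$, $z_\gamma\in DW_\gamma$, $$\{e_{\alpha\beta\gamma}*[(e_{\alpha\beta}*x_\alpha)*(e_{\alpha\beta}*y_\beta)]\}*(e_{\alpha\beta\gamma}*z_\gamma) = (e_{\alpha\beta\gamma}*x_\alpha)*\{e_{\alpha\beta\gamma}*[(e_{\beta\gamma}*y_\beta)*(e_{\beta\gamma}*z_\gamma)]\};$$ (iii) for all $\alpha,\beta\in Y$ and $x_\alpha\in DW_\alpha$, $y_\beta\in DW_\beta$, $$[e_{\alpha\beta}*(e_\alpha*x_\alpha)]*[e_{\alpha\beta}*(e_\beta*y_\beta)] = x_\alpha*y_\beta.$$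
   Context: A groupoid $(S,* )$ is a set $S$ with a binary operation $*$. A semigroup semilattice $Y$ is a commutative semigroup all of whose elements are idempotent; its product is written $\alpha\beta$. A groupoid $(S,* )$ is a semigroup semilattice $Y$ of groupoids $(T_\alpha,*|_{T_\alpha})$ $(\alpha\in Y)$ if $Y$ is a semigroup semilattice, $S$ is the disjoint union of the nonempty subsets $T_\alpha$ and $T_\alpha * T_\beta\subseteq T_{\alpha\beta}$ for all $\alpha,\beta\in Y$ ($*$ itself need not be associative). A semigroup semilattice of groups is a semigroup $(S,\bullet)$ (so $\bullet$ is associative) that is a semigroup semilattice $Y$ of groupoids each of which is a group $(G_\alpha,\bullet|_{G_\alpha},e_\alpha)$ with identity $e_\alpha$. A quasigroup is a groupoid in which, for all $a,b$, the equations $a*x=b$ and $y*a=b$ have unique solutions. A double Ward quasigroup $(DW,*,e)$ is a quasigroup $(DW,* )$ with an element $e\in DW$ such that $[(e*e)*(x*z)]*[(e*y)*z]=x*y$ for all $x,y,z$. The element $e$ need not be determined by $*$; a member of $\mathcal{SLDWQ}$ is therefore understood as $(S,* )$ together with its decomposition into the $DW_\alpha$ and the chosen elements $e_\alpha$ (up to relabelling of $Y$). The symbol $\cong$ denotes isomorphism of groupoids; condition (i) includes that $\{e_\alpha\}$ is closed under $*$. Two collections of structures are in one-to-one correspondence when there are mutually inverse assignments between them preserving the underlying set, i.e. for every set $S$ a bijection between the structures on $S$ of one kind and those of the other. *)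

(* Defs.v *)
From mathcomp Require Import all_boot.
From mathcomp Require Import boolp classical_sets functions.

Set Implicit Arguments.
Unset Strict Implicit.
Unset Printing Implicit Defensive.

Local Open Scope classical_set_scope.

(* The operation [op] is total on [S]; the predicates below are about the
   groupoid that it induces on a subset [A] of [S]. *)

Definition is_subgroupoid (S : Type) (op : S -> S -> S) (A : set S) : Prop :=
  forall x y, A x -> A y -> A (op x y).

Definition is_group (S : Type) (op : S -> S -> S) (A : set S) (e : S) : Prop :=
  [/\ is_subgroupoid op A,
      forall x y z, A x -> A y -> A z -> op x (op y z) = op (op x y) z,
      A e,
      forall x, A x -> op e x = x /\ op x e = x
    & forall x, A x -> exists y, [/\ A y, op y x = e & op x y = e]].

Definition is_quasigroup (S : Type) (op : S -> S -> S) (A : set S) : Prop :=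
  [/\ is_subgroupoid op A,
      forall a b, A a -> A b -> exists! x, A x /\ op a x = b
    & forall a b, A a -> A b -> exists! y, A y /\ op y a = b].

Definition is_double_ward_quasigroup
    (S : Type) (op : S -> S -> S) (A : set S) (e : S) : Prop :=
  [/\ is_quasigroup op A,
      A e
    & forall x y z, A x -> A y -> A z ->
        op (op (op e e) (op x z)) (op (op e y) z) = op x y].

Definition is_semigroup_semilattice (Y : Type) (m : Y -> Y -> Y) : Prop :=
  [/\ associative m, commutative m & idempotent_op m].

Definition is_semilattice_of_groupoids (S : Type) (op : S -> S -> S)
    (Y : Type) (m : Y -> Y -> Y) (T : Y -> set S) : Prop :=
  [/\ is_semigroup_semilattice m,
      forall a, T a !=set0,
      trivIset [set: Y] T,
      \bigcup_a T a = [set: S]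
    & forall a b x y, T a x -> T b y -> T (m a b) (op x y)].

Definition is_semilattice_of_groups (S : Type) (op : S -> S -> S) : Prop :=
  associative op /\
  exists (Y : Type) (m : Y -> Y -> Y) (G : Y -> set S) (e : Y -> S),
    is_semilattice_of_groupoids op m G /\ forall a, is_group op (G a) (e a).

(* [(A, op) ~= (Y, m)] for a subset [A] of [S]; closure of [A] under [op]
   is part of the notion. *)
Definition subgroupoid_isomorphic (S : Type) (op : S -> S -> S) (A : set S)
    (Y : Type) (m : Y -> Y -> Y) : Prop :=
  is_subgroupoid op A /\
  exists2 phi : Y -> S, set_bij [set: Y] A phi
    & forall a b, phi (m a b) = op (phi a) (phi b).

Definition is_SLDWQ_family (S : Type) (op : S -> S -> S)
    (Y : Type) (m : Y -> Y -> Y) (DW : Y -> set S) (e : Y -> S) : Prop :=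
  [/\ is_semilattice_of_groupoids op m DW
        /\ (forall a, is_double_ward_quasigroup op (DW a) (e a)),
      subgroupoid_isomorphic op (range e) m,
      forall a b c x y z, DW a x -> DW b y -> DW c z ->
        let eabc := e (m (m a b) c) in
        let eab := e (m a b) in
        let ebc := e (m b c) in
        op (op eabc (op (op eab x) (op eab y))) (op eabc z)
        = op (op eabc x) (op eabc (op (op ebc y) (op ebc z)))
    & forall a b x y, DW a x -> DW b y ->
        let eab := e (m a b) in
        op (op eab (op (e a) x)) (op eab (op (e b) y)) = op x y].

(* The decomposition is recorded as the set [D] of all pairs
   [(DW a, e a)].  The [DW a] being nonempty and pairwise disjoint, two
   families give the same [D] exactly when they differ by a relabelling of
   [Y]; the product of [Y] is then determined by [op]. *)
Definition is_SLDWQ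
    (S : Type) (op : S -> S -> S) (D : set (set S * S)) : Prop :=
  exists (Y : Type) (m : Y -> Y -> Y) (DW : Y -> set S) (e : Y -> S),
    is_SLDWQ_family op m DW e /\ D = range (fun a => (DW a, e a)).

Record SLG (S : Type) : Type := MkSLG {
  SLG_op : S -> S -> S;
  SLG_axiom : is_semilattice_of_groups SLG_op }.

Record SLDWQ (S : Type) : Type := MkSLDWQ {
  SLDWQ_op : S -> S -> S;
  SLDWQ_blocks : set (set S * S);
  SLDWQ_axiom : is_SLDWQ SLDWQ_op SLDWQ_blocks }.

(* Main.v *)
(** In a double Ward quasigroup whose element [e] is idempotent, [x |-> e * x] is
    an involution, and [x . y := (e * x) * (e * y)] is a group multiplication with
    identity [e] and inverse [x |-> e * x]; conversely [x * y = x^-1 . y^-1].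
    Over a semilattice, [x . y := (e_ab * x) * (e_ab * y)] for [x] in [DW_a] and
    [y] in [DW_b], while [x * y := x^-1 . y^-1] still makes sense, the inverses
    being taken in the respective groups.  Condition (i) makes each [e_a]
    idempotent, (ii) is the associativity of [.], and (iii) says that [*] is
    recovered from [.].  In the other direction, everything rests on the fact
    that the idempotents of a semilattice of groups are central. *)

Require Import Defs.
From mathcomp Require Import all_boot.
From mathcomp Require Import boolp classical_sets functions.

Set Implicit Arguments.
Unset Strict Implicit.
Unset Printing Implicit Defensive.

Local Open Scope classical_set_scope.

(** * Components of a semilattice of groupoids, and inverses defined without them *)

Lemma semilattice_component_inj (S : Type) (op : S -> S -> S) (Y : Type)
    (m : Y -> Y -> Y) (T : Y -> set S) :
  is_semilattice_of_groupoids op m T ->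
  forall a b x, T a x -> T b x -> a = b.
Proof. by case=> _ _ Tdisj _ _ a b x Tax Tbx; apply: Tdisj => //; exists x. Qed.

Lemma semilattice_component_ex (S : Type) (op : S -> S -> S) (Y : Type)
    (m : Y -> Y -> Y) (T : Y -> set S) :
  is_semilattice_of_groupoids op m T -> forall x, exists a, T a x.
Proof.
case=> _ _ _ Tcov _ x.
have : (\bigcup_a T a) x by rewrite Tcov.
by case=> a _ Tax; exists a.
Qed.

(* The conditions characterize the inverse in a semilattice of groups without
   reference to the decomposition; [x] is only a junk default value. *)
Definition group_inverse (S : Type) (op : S -> S -> S) (x : S) : S :=
  @xget {classic S} x
    [set y | [/\ op (op x y) x = x, op (op y x) y = y & op x y = op y x]].

Definition inverse_product (S : Type) (op : S -> S -> S) (x y : S) : S :=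
  op (group_inverse op x) (group_inverse op y).

(** The decomposition is read off from [op] alone: in a semilattice of groups the idempotents are
    exactly the identities [e a], and [x] belongs to the group whose identity is [x] times its
    inverse. *)
Definition group_blocks (S : Type) (op : S -> S -> S) : set (set S * S) :=
  [set Ae | op Ae.2 Ae.2 = Ae.2 /\
            Ae.1 = [set x | op x (group_inverse op x) = Ae.2]].

(** * From groups to double Ward quasigroups: central units and inverses across components *)

Section GroupsToDoubleWard.

Variables (S : Type) (op : S -> S -> S) (Y : Type) (m : Y -> Y -> Y).
Variables (G : Y -> set S) (e : Y -> S).

Hypothesis opA : associative op.
Hypothesis slG : is_semilattice_of_groupoids op m G.
Hypothesis grpG : forall a, is_group op (G a) (e a).

Local Notation "x • y" := (op x y) (at level 40, left associativity).
Local Notation inv := (group_inverse op).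
Local Notation star := (inverse_product op).

Lemma group_unitP a : G a (e a).
Proof. by case: (grpG a). Qed.

Lemma group_mul1 a x : G a x -> e a • x = x.
Proof. by case: (grpG a) => _ _ _ H _ /H []. Qed.

Lemma group_mulx1 a x : G a x -> x • e a = x.
Proof. by case: (grpG a) => _ _ _ H _ /H []. Qed.

Lemma group_idempotent a x : G a x -> x • x = x -> x = e a.
Proof.
move=> Gx xx; case: (grpG a) => _ _ _ _ /(_ _ Gx) [y [_ yx _]].
by rewrite -{1}(group_mul1 Gx) -yx -opA xx.
Qed.

Lemma component_mul a b x y : G a x -> G b y -> G (m a b) (x • y).
Proof. by case: slG => _ _ _ _; apply. Qed.

Lemma group_inverse_uniq a x y : G a x -> G a y -> x • y = e a -> inv x = y.
Proof.
move=> Gx Gy xy.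
have yx : y • x = e a.
  case: (grpG a) => _ _ _ _ /(_ _ Gx) [z [Gz zx _]].
  by rewrite -(group_mul1 Gy) -zx -(opA z) xy (group_mulx1 Gz) zx.
apply: (@xget_unique {classic S}).
  by split; rewrite ?xy ?yx ?(group_mul1 Gx) ?(group_mul1 Gy).
move=> z [xzx zxz xz].
have [b Gz] := semilattice_component_ex slG z.
have [mA mC mI] : is_semigroup_semilattice m by case: slG.
(* The equation [xzx = x] puts [a] below [b] and [zxz = z] puts [b] below [a]. So [z] lies in the
   group of [x], where the idempotent [xz] must be the identity. *)
have eab : a = m a b.
  apply: (semilattice_component_inj slG Gx).
  have := component_mul (component_mul Gx Gz) Gx.
  by rewrite xzx -mA (mC b) mA mI.
have eba : b = m a b.
  apply: (semilattice_component_inj slG Gz).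
  have := component_mul (component_mul Gz Gx) Gz.
  by rewrite zxz mC mA mI mC.
have {eab eba Gz} Gz : G a z by rewrite eab -eba.
have xze : x • z = e a.
  apply: group_idempotent; last by rewrite opA xzx.
  by rewrite -[X in G X](mI a); apply: component_mul.
by rewrite -(group_mul1 Gz) -yx -opA xze (group_mulx1 Gy).
Qed.

Lemma group_inverseP a x : G a x -> [/\ G a (inv x), inv x • x = e a & x • inv x = e a].
Proof.
move=> Gx; case: (grpG a) => _ _ _ _ /(_ _ Gx) [y [Gy yx xy]].
by rewrite (group_inverse_uniq Gx Gy xy).
Qed.

Lemma group_inverseK a x : G a x -> inv (inv x) = x.
Proof. by move=> Gx; case: (group_inverseP Gx) => Gix ix _; apply: group_inverse_uniq ix. Qed.

Lemma group_inverse1 a : inv (e a) = e a.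
Proof.
by apply: (group_inverse_uniq (group_unitP a) (group_unitP a));
   apply: group_mul1 (group_unitP a).
Qed.

Lemma mul_unit_component a c x : m a c = c -> G a x -> G c (x • e c).
Proof.
by move=> ac Gx; rewrite -[X in G X]ac; apply: component_mul => //; apply: group_unitP.
Qed.

(** The hypothesis says [c <= a] in the semilattice order. Both products then lie in [G c], where
    [e c] is neutral, so both equal [e c • x • e c]. *)
Lemma unit_commute a c x : m a c = c -> G a x -> x • e c = e c • x.
Proof.
move=> ac Gx; have [mA mC mI] : is_semigroup_semilattice m by case: slG.
have Gxc := mul_unit_component ac Gx.
have Gcx : G c (e c • x).
  by rewrite -[X in G X]ac mC; apply: component_mul => //; apply: group_unitP.
by rewrite -(group_mul1 Gxc) opA (group_mulx1 Gcx).
Qed.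

Lemma unit_mul_le a c : m a c = c -> e a • e c = e c.
Proof.
move=> ac; apply: group_idempotent.
  by rewrite -[X in G X]ac; apply: component_mul; apply: group_unitP.
rewrite opA -(opA _ (e c)) -(unit_commute ac (group_unitP a)).
by rewrite opA (group_mul1 (group_unitP a)) -opA (group_mul1 (group_unitP c)).
Qed.

Lemma semilattice_leL a b : m a (m a b) = m a b.
Proof. by case: slG => [[mA _ mI] _ _ _ _]; rewrite mA mI. Qed.

Lemma semilattice_leR a b : m b (m a b) = m a b.
Proof. by case: slG => [[mA mC mI] _ _ _ _]; rewrite mC -mA mI. Qed.

(** Reduces a product across components to one inside the single group [G (m a b)]; multiplication
    by the unit of a lower component is the structure map into it. *)
Lemma group_mul_unit a b x y : G a x -> G b y ->
  x • y = (x • e (m a b)) • (y • e (m a b)).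
Proof.
move=> Gx Gy; have Gye := mul_unit_component (semilattice_leR a b) Gy.
by rewrite -(opA x) (group_mul1 Gye) opA (group_mulx1 (component_mul Gx Gy)).
Qed.

Lemma unit_mul a b : e a • e b = e (m a b).
Proof.
rewrite (group_mul_unit (group_unitP a) (group_unitP b)).
rewrite (unit_mul_le (semilattice_leL a b)) (unit_mul_le (semilattice_leR a b)).
exact: group_mul1 (group_unitP _).
Qed.

Lemma group_inverseM a b x y : G a x -> G b y -> inv (x • y) = inv y • inv x.
Proof.
move=> Gx Gy; have mC : commutative m by case: slG => [[]].
have [Gix ix xi] := group_inverseP Gx; have [Giy iy yi] := group_inverseP Gy.
apply: (group_inverse_uniq (component_mul Gx Gy)).
  by rewrite mC; apply: component_mul.
rewrite opA -(opA x) yi.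
(* What remains is [x • e b • inv x], an element of [G (m a b)], so a factor [e (m a b)] may be
   appended. Being central enough, it moves left to absorb [e b], then past [x], leaving
   [e (m a b) • e a]. *)
rewrite -(group_mulx1 (component_mul (component_mul Gx (group_unitP b)) Gix)).
have -> : m (m a b) a = m a b by rewrite mC semilattice_leL.
rewrite -(opA _ (inv x)) (unit_commute (semilattice_leL a b) Gix) opA.
rewrite -(opA x) (unit_mul_le (semilattice_leR a b)).
by rewrite (unit_commute (semilattice_leL a b) Gx) -opA xi
   -(unit_commute (semilattice_leL a b) (group_unitP a)) (unit_mul_le (semilattice_leL a b)).
Qed.

Lemma star_component a b x y : G a x -> G b y -> G (m a b) (star x y).
Proof. by move=> /group_inverseP [Gx _ _] /group_inverseP [Gy _ _]; apply: component_mul. Qed.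

Lemma star_unit a x : G a x -> star (e a) x = inv x.
Proof.
by move=> /group_inverseP [Gx _ _]; rewrite /inverse_product group_inverse1 (group_mul1 Gx).
Qed.

(** The inverse of [star (e (m a b)) x] is [x • e (m a b)], so the outer [star] multiplies the
    images of [x] and [y] in [G (m a b)]. This recovers [op] from [star] and drives both (ii) and
    (iii). *)
Lemma star_unit_mul a b x y : G a x -> G b y ->
  star (star (e (m a b)) x) (star (e (m a b)) y) = x • y.
Proof.
move=> Gx Gy; rewrite {1}/inverse_product.
have [Gix _ _] := group_inverseP Gx; have [Giy _ _] := group_inverseP Gy.
rewrite {1 2}/inverse_product group_inverse1.
rewrite (group_inverseM (group_unitP _) Gix) (group_inverseM (group_unitP _) Giy).
by rewrite group_inverse1 (group_inverseK Gx) (group_inverseK Gy) -group_mul_unit.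
Qed.

Lemma star_double_ward a : is_double_ward_quasigroup star (G a) (e a).
Proof.
have maa : m a a = a by case: slG => [[]].
have Gstar x y : G a x -> G a y -> G a (star x y).
  by move=> Gx Gy; rewrite -maa; apply: star_component.
have Gop x y : G a x -> G a y -> G a (x • y).
  by move=> Gx Gy; rewrite -maa; apply: component_mul.
split; first split => //.
- move=> x b Gx Gb; have [Gix ix xi] := group_inverseP Gx.
  have [Gib ib bi] := group_inverseP Gb.
  (* Solves [inv x • inv y = b] for [y]; the mirrored equation below is solved by
     [inv x • inv b]. *)
  exists (inv b • inv x); split.
    split; first exact: Gop.
    rewrite /inverse_product (group_inverseM Gib Gix) (group_inverseK Gx) (group_inverseK Gb).
    by rewrite opA ix (group_mul1 Gb).
  move=> y [Gy <-]; rewrite /inverse_product.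
  have [Giy _ _] := group_inverseP Gy.
  rewrite (group_inverseM Gix Giy) (group_inverseK Gx) (group_inverseK Gy).
  by rewrite -opA xi (group_mulx1 Gy).
- move=> x b Gx Gb; have [Gix ix xi] := group_inverseP Gx.
  have [Gib ib bi] := group_inverseP Gb.
  exists (inv x • inv b); split.
    split; first exact: Gop.
    rewrite /inverse_product (group_inverseM Gix Gib) (group_inverseK Gx) (group_inverseK Gb).
    by rewrite -opA xi (group_mulx1 Gb).
  move=> y [Gy <-]; rewrite /inverse_product.
  have [Giy _ _] := group_inverseP Gy.
  rewrite (group_inverseM Giy Gix) (group_inverseK Gx) (group_inverseK Gy).
  by rewrite opA ix (group_mul1 Gy).
- exact: group_unitP.
- move=> x y z Gx Gy Gz.
  have [Gix _ _] := group_inverseP Gx; have [Giy _ _] := group_inverseP Gy.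
  have [Giz iz _] := group_inverseP Gz.
  rewrite (star_unit (group_unitP a)) group_inverse1 (star_unit (Gstar _ _ Gx Gz)).
  rewrite (star_unit Gy) /inverse_product (group_inverseK (Gop _ _ Gix Giz)).
  rewrite (group_inverseK Gy) (group_inverseM Gy Giz) (group_inverseK Gz).
  by rewrite opA -(opA _ (inv z)) iz -opA (group_mul1 Giy).
Qed.

Lemma star_SLDWQ : is_SLDWQ_family star m G e.
Proof.
have [[mA mC mI] Gn Gdisj Gcov Gmul] := slG.
split.
- split; last exact: star_double_ward.
  by split => // *; apply: star_component.
- have eM a b : e (m a b) = star (e a) (e b).
    by rewrite /inverse_product !group_inverse1 unit_mul.
  split; first by move=> _ _ [a _ <-] [b _ <-]; exists (m a b).
  exists e => //; split.
  + by move=> a _; exists a.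
  + move=> a b _ _ eab; apply: (semilattice_component_inj slG (group_unitP a)).
    by rewrite eab; apply: group_unitP.
  + by move=> _ [a _ <-]; exists a.
- move=> a b c x y z Gx Gy Gz /=.
  (* Every bracket collapses to a product under [op], which turns (ii) into associativity. *)
  rewrite (star_unit_mul Gx Gy) (star_unit_mul Gy Gz).
  rewrite (star_unit_mul (component_mul Gx Gy) Gz) -mA.
  by rewrite (star_unit_mul Gx (component_mul Gy Gz)) opA.
- move=> a b x y Gx Gy /=; rewrite (star_unit Gx) (star_unit Gy).
  by apply: star_unit_mul; [case: (group_inverseP Gx)|case: (group_inverseP Gy)].
Qed.

Lemma group_blocksE : group_blocks op = range (fun a => (G a, e a)).
Proof.
have GE a : G a = [set x | x • inv x = e a].
  apply/seteqP; split => x /=; first by case/group_inverseP.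
  have [b Gx] := semilattice_component_ex slG x.
  have [_ _ ->] := group_inverseP Gx => eba.
  have -> // : a = b.
  by apply: (semilattice_component_inj slG (group_unitP a)); rewrite -eba; apply: group_unitP.
apply/seteqP; split => [[A f] [/= ff /= ->]|_ [a _ <-]].
  have [a Gf] := semilattice_component_ex slG f.
  by exists a => //; rewrite GE (group_idempotent Gf ff).
by split; [exact: group_mul1 (group_unitP a)|exact: GE].
Qed.

End GroupsToDoubleWard.

(** * The group product attached to a decomposition into double Ward quasigroups *)

Definition block_unit (S : Type) (D : set (set S * S)) (x : S) : S :=
  @xget {classic S} x [set e | exists2 A, D (A, e) & A x].

(* For [x] in [DW_a] and [y] in [DW_b], the product [op x y] lies in [DW_ab], so
   [block_unit D (op x y)] is [e_ab]. *)
Definition ward_product (S : Type) (op : S -> S -> S) (D : set (set S * S))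
    (x y : S) : S :=
  let e := block_unit D (op x y) in op (op e x) (op e y).

(** * Arithmetic of a single double Ward quasigroup with idempotent [e] *)

Section DoubleWardUnit.

Variables (S : Type) (op : S -> S -> S) (A : set S) (e : S).

Hypothesis dwA : is_double_ward_quasigroup op A e.
Hypothesis ee : op e e = e.

Local Notation "x * y" := (op x y).

Let Aop x y : A x -> A y -> A (x * y).
Proof. by case: dwA => [[H _ _] _ _]; apply: H. Qed.

Let Ae : A e. Proof. by case: dwA. Qed.

Let wardE x y z : A x -> A y -> A z -> (e * (x * z)) * ((e * y) * z) = x * y.
Proof. by case: dwA => _ _ H Ax Ay Az; rewrite -[RHS](H x y z) // ee. Qed.

Let unit_mul_surj w : A w -> exists2 z, A z & e * z = w.
Proof.
by case: dwA => [[_ ql _] _ _] Aw; have [z [[Az ez] _]] := ql e w Ae Aw; exists z.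
Qed.

(** Write [w = e * z] and take the first two variables of the Ward identity to be [e]. *)
Lemma ward_mulVx w : A w -> (e * w) * w = e.
Proof. by case/unit_mul_surj => z Az <-; rewrite -[RHS]ee -(wardE Ae Ae Az) ee. Qed.

(** With [x = e * z], the Ward identity at [e, z, z] has right factor [(e * z) * z], which is
    [e]. *)
Lemma ward_mulV_unit x : A x -> (e * x) * e = x.
Proof.
move=> Ax; have [z Az <-] := unit_mul_surj Ax.
by have := wardE Ae Az Az; rewrite ward_mulVx.
Qed.

(** The Ward identity at [e * x, e, x] reduces to [e * (e * x) = (e * x) * e]. *)
Lemma ward_unitK x : A x -> e * (e * x) = x.
Proof.
move=> Ax; have Aex := Aop Ae Ax.
by have := wardE Aex Ae Ax; rewrite ward_mulVx // !ee ward_mulV_unit.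
Qed.

End DoubleWardUnit.

(** * From double Ward quasigroups over a semilattice to groups *)

Section DoubleWardToGroups.

Variables (S : Type) (op : S -> S -> S) (Y : Type) (m : Y -> Y -> Y).
Variables (DW : Y -> set S) (e : Y -> S).

Hypothesis fam : is_SLDWQ_family op m DW e.

Local Notation "x * y" := (op x y).
Local Notation D := (range (fun a => (DW a, e a))).
Local Notation dot := (ward_product op D).

Let slW : is_semilattice_of_groupoids op m DW.
Proof. by case: fam => [[]]. Qed.

Let dwW a : is_double_ward_quasigroup op (DW a) (e a).
Proof. by case: fam => [[_ H] _ _ _]; apply: H. Qed.

Let DWop a b x y : DW a x -> DW b y -> DW (m a b) (x * y).
Proof. by case: slW => _ _ _ _; apply. Qed.

Let DWe a : DW a (e a).
Proof. by case: (dwW a). Qed.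

Lemma ward_unit_idempotent a : e a * e a = e a.
Proof.
(* The isomorphism [phi] of (i) need not be [e]; surjectivity gives [e a = phi b] for some [b], and
   [b] is idempotent in the semilattice. *)
case: fam => _ [_ [phi [_ _ phi_surj] phiM]] _ _.
have [|b _ <-] := phi_surj (e a); first by exists a.
by case: slW => [[_ _ mI] _ _ _ _]; rewrite -phiM mI.
Qed.

Lemma block_unitE a x : DW a x -> block_unit D x = e a.
Proof.
move=> DWx; apply: (@xget_unique {classic S}).
  by exists (DW a) => //; exists a.
by move=> _ [_ [b _ [<- <-]] DWbx]; rewrite (semilattice_component_inj slW DWx DWbx).
Qed.

Lemma ward_productE a b x y : DW a x -> DW b y ->
  dot x y = (e (m a b) * x) * (e (m a b) * y).
Proof. by move=> DWx DWy; rewrite /ward_product (block_unitE (DWop DWx DWy)). Qed.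

Lemma ward_product_component a b x y : DW a x -> DW b y -> DW (m a b) (dot x y).
Proof.
move=> DWx DWy; have [[mA mC mI] _ _ _ _] := slW.
have le1 : m (m a b) a = m a b by rewrite mC mA mI.
have le2 : m (m a b) b = m a b by rewrite -mA mI.
rewrite (ward_productE DWx DWy) -[X in DW X]mI -{1}le1 -{2}le2.
by apply: DWop; apply: DWop.
Qed.

Lemma ward_productA : associative dot.
Proof.
move=> x y z; have [mA _ _] : is_semigroup_semilattice m by case: slW.
have [a DWx] := semilattice_component_ex slW x.
have [b DWy] := semilattice_component_ex slW y.
have [c DWz] := semilattice_component_ex slW z.
(* Once [mA] aligns the indices, both sides carry the same outer unit and the goal is (ii). *)
rewrite (ward_productE DWx (ward_product_component DWy DWz)) mA.
rewrite (ward_productE (ward_product_component DWx DWy) DWz).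
rewrite (ward_productE DWx DWy) (ward_productE DWy DWz).
by case: fam => _ _ /(_ a b c x y z DWx DWy DWz) /= -> _.
Qed.

Lemma ward_product_semilattice : is_semilattice_of_groupoids dot m DW.
Proof. by case: slW; split => // *; apply: ward_product_component. Qed.

Lemma ward_product_inverse a x : DW a x ->
  [/\ DW a (e a * x), dot (e a * x) x = e a & dot x (e a * x) = e a].
Proof.
move=> DWx; have maa : m a a = a by case: slW => [[]].
have ea := ward_unit_idempotent a.
have DWex : DW a (e a * x) by rewrite -[X in DW X]maa; apply: DWop.
rewrite (ward_productE DWex DWx) (ward_productE DWx DWex) maa.
split=> //; first exact: ward_mulVx (dwW a) ea _ DWex.
by rewrite (ward_unitK (dwW a) ea DWx); apply: ward_mulVx (dwW a) ea _ DWx.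
Qed.

Lemma ward_product_group a : is_group dot (DW a) (e a).
Proof.
have maa : m a a = a by case: slW => [[]].
have ea := ward_unit_idempotent a.
split => [x y DWx DWy|x y z _ _ _||x DWx|x DWx].
- by rewrite -maa; apply: ward_product_component.
- exact: ward_productA.
- exact: DWe.
- have [DWex _ _] := ward_product_inverse DWx.
  rewrite (ward_productE (DWe a) DWx) (ward_productE DWx (DWe a)) maa ea.
  by rewrite (ward_unitK (dwW a) ea DWx) (ward_mulV_unit (dwW a) ea DWx).
- by have [? ? ?] := ward_product_inverse DWx; exists (e a * x).
Qed.

(** The uniqueness of inverses proved for groups applies, since [dot] is now known to be a
    semilattice of groups on the same components. *)
Lemma ward_product_inverseE a x : DW a x -> group_inverse dot x = e a * x.
Proof.
move=> DWx; have [DWex _ xi] := ward_product_inverse DWx.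
exact: group_inverse_uniq ward_productA ward_product_semilattice ward_product_group
  _ _ _ DWx DWex xi.
Qed.

Lemma ward_productK : inverse_product dot = op.
Proof.
apply/funext => x; apply/funext => y.
have [a DWx] := semilattice_component_ex slW x.
have [b DWy] := semilattice_component_ex slW y.
rewrite /inverse_product (ward_product_inverseE DWx) (ward_product_inverseE DWy).
have [DWex _ _] := ward_product_inverse DWx.
have [DWey _ _] := ward_product_inverse DWy.
(* Expanding the product of the inverses [e a * x] and [e b * y] gives the left side of (iii). *)
by rewrite (ward_productE DWex DWey); case: fam => _ _ _ /(_ a b x y DWx DWy).
Qed.

End DoubleWardToGroups.

(** * The two assignments and their mutual inversion *)

Lemma inverse_product_SLDWQ (S : Type) (op : S -> S -> S) :
  is_semilattice_of_groups op -> is_SLDWQ (inverse_product op) (group_blocks op).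
Proof.
case=> opA [Y [m [G [e [slG grpG]]]]]; exists Y, m, G, e.
by split; [exact: star_SLDWQ|exact: group_blocksE slG grpG].
Qed.

Lemma ward_product_SLG (S : Type) (op : S -> S -> S) (D : set (set S * S)) :
  is_SLDWQ op D -> is_semilattice_of_groups (ward_product op D).
Proof.
case=> Y [m [DW [e [fam ->]]]]; split; first exact: ward_productA fam.
exists Y, m, DW, e; split; first exact: ward_product_semilattice fam.
by move=> a; exact: ward_product_group fam a.
Qed.

Lemma inverse_productK (S : Type) (op : S -> S -> S) :
  is_semilattice_of_groups op ->
  ward_product (inverse_product op) (group_blocks op) = op.
Proof.
case=> opA [Y [m [G [e [slG grpG]]]]].
have fam := star_SLDWQ opA slG grpG.
rewrite (group_blocksE opA slG grpG); apply/funext => x; apply/funext => y.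
have [a Gx] := semilattice_component_ex slG x.
have [b Gy] := semilattice_component_ex slG y.
by rewrite (ward_productE fam Gx Gy) (star_unit_mul opA slG grpG Gx Gy).
Qed.

(** The given blocks and units also decompose the new product into groups, and such a decomposition
    is determined by the product. *)
Lemma ward_product_blocks (S : Type) (op : S -> S -> S) (D : set (set S * S)) :
  is_SLDWQ op D -> group_blocks (ward_product op D) = D.
Proof.
case=> Y [m [DW [e [fam ->]]]].
apply: group_blocksE (ward_productA fam) _ _; first exact: ward_product_semilattice fam.
by move=> a; exact: ward_product_group fam a.
Qed.

Lemma ward_product_inverse_product (S : Type) (op : S -> S -> S)
    (D : set (set S * S)) :
  is_SLDWQ op D -> inverse_product (ward_product op D) = op.
Proof. by case=> Y [m [DW [e [fam ->]]]]; apply: ward_productK fam. Qed.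

Lemma SLG_eq (S : Type) (g h : SLG S) : SLG_op g = SLG_op h -> g = h.
Proof.
by case: g h => [o p] [o' p'] /= oo; subst o'; rewrite (Prop_irrelevance p p').
Qed.

Lemma SLDWQ_eq (S : Type) (g h : SLDWQ S) :
  SLDWQ_op g = SLDWQ_op h -> SLDWQ_blocks g = SLDWQ_blocks h -> g = h.
Proof.
case: g h => [o D p] [o' D' p'] /= oo DD; subst o' D'.
by rewrite (Prop_irrelevance p p').
Qed.

Theorem corollary3p16 :
  exists (Phi : forall S : Type, SLG S -> SLDWQ S)
         (Psi : forall S : Type, SLDWQ S -> SLG S),
    forall S : Type,
      cancel (Phi S) (Psi S) /\ cancel (Psi S) (Phi S).
Proof.
exists (fun S g => MkSLDWQ (inverse_product_SLDWQ (SLG_axiom g))).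
exists (fun S d => MkSLG (ward_product_SLG (SLDWQ_axiom d))).
move=> S; split=> [g|d].
  by apply: SLG_eq; apply: inverse_productK (SLG_axiom g).
apply: SLDWQ_eq; first exact: ward_product_inverse_product (SLDWQ_axiom d).
exact: ward_product_blocks (SLDWQ_axiom d).
Qed.
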